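(* Let $\mathbb{A}$ be an algebra, $n\ge 3$, and $(\theta_0,\dots,\theta_{n-1})\in\mathrm{Con}(\mathbb{A})^n$. Then for all $m$ with $1\le m\le n-2$, $$[\theta_0,\dots,\theta_{m-1},[\theta_m,\dots,\theta_{n-1}]_H]_H\le[\theta_0,\dots,\theta_{n-1}]_H.$$
   Context: Identify $k$ with $\{0,\dots,k-1\}$; $2^k$ is the set of functions $f:k\to\{0,1\}$, and for $\gamma\in A^{2^k}$ write $\gamma_f$ for its value at $f$. For $i\in k$, $\epsilon\in\{0,1\}$, $\mathrm{Faces}_i^\epsilon(\gamma)\in A^{2^{k\setminus\{i\}}}$ is $g\mapsto\gamma_{g\cup\{(i,\epsilon)\}}$; for $R\subseteq A^{2^k}$, $\mathrm{Faces}_i(R)=\{\langle\mathrm{Faces}_i^0(\gamma),\mathrm{Faces}_i^1(\gamma)\rangle:\gamma\in R\}$. A binary relation $E$ is quasireflexive if $\langle a,b\rangle\in E$ implies $\langle a,a\rangle,\langle b,b\rangle\in E$. A $k$-dimensional congruence of $\mathbb{A}$ is a subset $R\subseteq A^{2^k}$ compatible with the basic operations of $\mathbb{A}$ such that each $\mathrm{Faces}_i(R)$, $i\in k$, is quasireflexive, symmetric and transitive. $\mathrm{cube}_i(x,y)\in A^{2^k}$ has value $x$ at $f$ if $f_i=0$ and $y$ if $f_i=1$. For $k\ge2$ and $\beta_0,\dots,\beta_{k-1}\in\mathrm{Con}(\mathbb{A})$, $\Delta(\beta_0,\dots,\beta_{k-1})$ is the least $k$-dimensional congruence of $\mathbb{A}$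 containing $\bigcup_{i\in k}\{\mathrm{cube}_i(x,y):\langle x,y\rangle\in\beta_i\}$. For $i\in k$, $g\in 2^{k\setminus\{i\}}$, the $(i)$-cross-section line of $\gamma$ at $g$ is $\langle\gamma_{g\cup\{(i,0)\}},\gamma_{g\cup\{(i,1)\}}\rangle$. For $\delta\in\mathrm{Con}(\mathbb{A})$, $R\subseteq A^{2^k}$ has $(\delta,i)$-centrality if there is no $\gamma\in R$ for which exactly $2^{k-1}-1$ of its $2^{k-1}$ $(i)$-cross-section lines belong to $\delta$. The $k$-ary hypercommutator ($k\ge 2$) is $[\beta_0,\dots,\beta_{k-1}]_{H}=\bigwedge\{\delta\in\mathrm{Con}(\mathbb{A}):\Delta(\beta_0,\dots,\beta_{k-1})\text{ has }(\delta,k-1)\text{-centrality}\}$. The expression $[\theta_m,\dots,\theta_{n-1}]_H$ is the $(n-m)$-ary hypercommutator applied to the tuple in this order. *)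

(* Defs.v *)
From Corelib Require Export RelationClasses.
From mathcomp Require Export all_boot.
From mathcomp Require Export boolp classical_sets.

Set Implicit Arguments.
Unset Strict Implicit.
Unset Printing Implicit Defensive.

Local Open Scope classical_set_scope.

Record signature := Signature { symbol : Type; arity : symbol -> nat }.

Record algebra (S : signature) := Algebra {
  carrier :> Type;
  op : forall s : symbol S, ('I_(arity s) -> carrier) -> carrier }.

Record Con (S : signature) (A : algebra S) := Congruence {
  con_rel :> A -> A -> Prop;
  con_equiv : Equivalence con_rel;
  con_compat : forall (s : symbol S) (x y : 'I_(arity s) -> A),
    (forall j, con_rel (x j) (y j)) -> con_rel (op x) (op y) }.

Definition con_le (S : signature) (A : algebra S) (d e : Con A) : Prop :=
  forall x y : A, d x y -> e x y.

(* The meet of the empty family is the total congruence. *)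
Section Meet.
Variables (S : signature) (A : algebra S) (P : set (Con A)).

Definition con_meet_rel (x y : A) : Prop := forall d : Con A, P d -> d x y.

Lemma con_meet_equiv : Equivalence con_meet_rel.
Proof.
split=> [x d _|x y xy d Pd|x y z xy yz d Pd]; have [dr ds dt] := con_equiv d.
- exact: dr.
- exact/ds/xy.
- exact: dt (xy d Pd) (yz d Pd).
Qed.

Lemma con_meet_compat (s : symbol S) (x y : 'I_(arity s) -> A) :
  (forall j, con_meet_rel (x j) (y j)) -> con_meet_rel (op x) (op y).
Proof. by move=> xy d Pd; apply: con_compat => j; apply: xy. Qed.

Definition con_meet : Con A := Congruence con_meet_equiv con_meet_compat.

End Meet.

(* The domains 2^k and 2^(k \ {i}) are finite types; [cube A k] and [face A i]
   are the powers A^(2^k) and A^(2^(k \ {i})). *)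
Definition vertex (k : nat) := {ffun 'I_k -> bool}.
Definition face_vertex (k : nat) (i : 'I_k) :=
  {ffun {j : 'I_k | j != i} -> bool}.
Definition cube (A : Type) (k : nat) := vertex k -> A.
Definition face (A : Type) (k : nat) (i : 'I_k) := face_vertex i -> A.

(* g `|` {(i, e)} *)
Definition extend (k : nat) (i : 'I_k) (e : bool) (g : face_vertex i) :
  vertex k := [ffun j => if insub j is Some j' then g j' else e].

Definition cube_face (A : Type) (k : nat) (i : 'I_k) (e : bool)
  (c : cube A k) : face A i := fun g => c (extend e g).
Arguments cube_face {A k} i e c _.

Definition faces (A : Type) (k : nat) (i : 'I_k) (R : set (cube A k)) :
  face A i -> face A i -> Prop :=
  fun x y => exists2 c, R c & x = cube_face i false c /\ y = cube_face i true c.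
Arguments faces {A k} i R _ _.

Definition quasireflexive (T : Type) (E : T -> T -> Prop) : Prop :=
  forall a b, E a b -> E a a /\ E b b.

Definition compatible (S : signature) (A : algebra S) (k : nat)
  (R : set (cube A k)) : Prop :=
  forall (s : symbol S) (c : 'I_(arity s) -> cube A k),
    (forall j, R (c j)) -> R (fun f => op (fun j => c j f)).

Definition dim_congruence (S : signature) (A : algebra S) (k : nat)
  (R : set (cube A k)) : Prop :=
  compatible R /\
  forall i : 'I_k,
    [/\ quasireflexive (faces i R), Symmetric (faces i R)
      & Transitive (faces i R)].

Definition cube_pair (A : Type) (k : nat) (i : 'I_k) (x y : A) : cube A k :=
  fun f => if f i then y else x.

Definition Delta (S : signature) (A : algebra S) (k : nat)
  (beta : k.-tuple (Con A)) : set (cube A k) :=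
  smallest (@dim_congruence S A k)
    [set c | exists i x y, tnth beta i x y /\ c = cube_pair i x y].

(* [line_in d i c g]: the (i)-cross-section line of c at g belongs to d. *)
Definition line_in (S : signature) (A : algebra S) (k : nat) (d : Con A)
  (i : 'I_k) (c : cube A k) (g : face_vertex i) : Prop :=
  d (c (extend false g)) (c (extend true g)).

Definition centrality (S : signature) (A : algebra S) (k : nat) (d : Con A)
  (i : 'I_k) (R : set (cube A k)) : Prop :=
  ~ exists2 c, R c &
      #|[pred g : face_vertex i | `[< line_in d c g >]]| = 2 ^ (k - 1) - 1.

(* Only meaningful for 2 <= k, in which case the quantifier over i ranges over
   the single index k - 1. *)
Definition hypercommutator (S : signature) (A : algebra S) (k : nat)
  (beta : k.-tuple (Con A)) : Con A :=
  con_meet [set d : Con A |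
    forall i : 'I_k, i = k - 1 :> nat -> centrality d i (Delta beta)].

(* Main.v *)
(* A k-dimensional congruence is a compatible set of cubes that is closed, in
   each direction, under duplicating a face, reflecting, and gluing two cubes
   along a common face.  Two-dimensional gluing shows that the cubes factoring
   through the conjunction of two coordinates again form a congruence, of
   dimension one less; iterating, the last n - m coordinates of a cube may be
   merged into their conjunction.  Merging all the coordinates of
   Delta(beta) makes "x everywhere except y at the top vertex lies in
   Delta(beta)" a congruence; gluing shows that Delta(beta) is central with
   respect to it, so it contains the hypercommutator.  Hence every cube c of
   Delta(theta_0, .., theta_(m-1), [theta_m, .., theta_(n-1)]) yields the cube
   f |-> c(f_0, .., f_(m-1), f_m /\ .. /\ f_(n-1)) of Delta(theta).  Its
   lines in the last direction are those of c, each once, and trivial ones, so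
   centrality transfers from the latter to the former. *)
Require Import Defs.
From mathcomp Require Import zify.

Set Implicit Arguments.
Unset Strict Implicit.
Unset Printing Implicit Defensive.

Local Open Scope classical_set_scope.

(** * Coordinate updates, centrality and closure in one direction *)

Definition upd (k : nat) (f : vertex k) (i : 'I_k) (b : bool) : vertex k :=
  [ffun j => if j == i then b else f j].

Lemma updE k (f : vertex k) i b j :
  upd f i b j = if j == i then b else f j.
Proof. by rewrite ffunE. Qed.

Lemma upd_same k (f : vertex k) i b : upd f i b i = b.
Proof. by rewrite updE eqxx. Qed.

Lemma upd_upd k (f : vertex k) i b b' : upd (upd f i b) i b' = upd f i b'.
Proof. by apply/ffunP => j; rewrite !updE; case: eqP. Qed.

Lemma upd_id k (f : vertex k) i b : f i = b -> upd f i b = f.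
Proof. by move=> <-; apply/ffunP => j; rewrite updE; case: eqP => [->|]. Qed.

Lemma upd_neq k (f v : vertex k) i b : b != v i -> (upd f i b == v) = false.
Proof. by move=> bv; apply/eqP => fv; rewrite -fv upd_same eqxx in bv. Qed.

Definition restrict (k : nat) (i : 'I_k) (f : vertex k) : face_vertex i :=
  [ffun j => f (val j)].

Lemma restrictK k (i : 'I_k) e (f : vertex k) :
  extend e (restrict i f) = upd f i e.
Proof.
apply/ffunP => j; rewrite !ffunE; case: insubP => [j' ji <-|/negbNE ->] //.
by rewrite ffunE (negbTE (valP j')).
Qed.

Lemma extend_dir k (i : 'I_k) e (g : face_vertex i) : extend e g i = e.
Proof. by rewrite ffunE insubF ?eqxx. Qed.

Lemma extendK k (i : 'I_k) e : cancel (@extend k i e) (@restrict k i).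
Proof. by move=> g; apply/ffunP => j; rewrite !ffunE valK. Qed.

Lemma upd_extend k (i : 'I_k) b e (g : face_vertex i) :
  upd (extend b g) i e = extend e g.
Proof. by rewrite -restrictK extendK. Qed.

Lemma card_face_vertex k (i : 'I_k) : #|{: face_vertex i}| = 2 ^ (k - 1).
Proof.
by rewrite card_ffun card_bool card_sig (cardC1 i) card_ord subn1.
Qed.

(** A count one short of the number of lines means that a single line lies outside [d], so
    centrality infers the line through [v] from all the others. Naming a line by any vertex on it
    avoids the dependent type [face_vertex]. *)
Lemma centralityP (S : signature) (A : algebra S) k (d : Con A) (i : 'I_k)
    (R : set (cube A k)) :
  centrality d i R <->
  forall c (v : vertex k), R c ->
    (forall f, upd f i false != upd v i false ->
       d (c (upd f i false)) (c (upd f i true))) ->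
    d (c (upd v i false)) (c (upd v i true)).
Proof.
split=> [ctr c v Rc off|ctr [c Rc cardP]].
- apply: contrapT => dv; apply: ctr; exists c => //.
  rewrite -(card_face_vertex i) subn1 -(cardC1 (restrict i v)).
  apply: eq_card => g; rewrite !inE; apply/asboolP/idP => [dg|gv].
    apply/eqP => gv; apply: dv; move: dg.
    by rewrite gv /line_in !restrictK.
  have := off (extend false g); rewrite !upd_extend; apply.
  by apply: contra gv => /eqP gv; rewrite -(extendK false g) gv -restrictK extendK.
- set P := [pred g | _] in cardP.
  have : #|predC P| == 1.
    have := cardC P; rewrite card_face_vertex cardP.
    have : 0 < 2 ^ (k - 1) by rewrite expn_gt0.
    move: (2 ^ _) #|_| => N M; lia.
  case/card1P => g0 Pg0; have := Pg0 g0; rewrite !inE eqxx => /asboolPn; apply.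
  have := ctr c (extend false g0) Rc; rewrite !upd_extend; apply=> f fg.
  have := Pg0 (restrict i f); rewrite !inE /line_in !restrictK.
  have -> : (restrict i f == g0) = false.
    by apply: contraNF fg => /eqP <-; rewrite restrictK.
  by move/negbFE/asboolP.
Qed.

(** The fields mirror quasireflexivity, symmetry and transitivity of [faces i R], but as closure
    conditions on whole cubes. *)
Record dir_closed (T : Type) (k : nat) (i : 'I_k) (R : set (cube T k)) : Prop := {
  dir_cut : forall c e, R c -> R (fun f => c (upd f i e));
  dir_flip : forall c, R c -> R (fun f => c (upd f i (~~ f i)));
  dir_glue : forall a b, R a -> R b ->
    (forall f, a (upd f i true) = b (upd f i false)) ->
    R (fun f => if f i then b f else a f) }.

(** A cube is determined by its two faces in direction [i], so a pair related by [faces i R]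
    recovers the member of [R] it comes from. *)
Lemma dir_closedP (T : Type) k (i : 'I_k) (R : set (cube T k)) :
  [/\ quasireflexive (faces i R), Symmetric (faces i R)
    & Transitive (faces i R)] <-> dir_closed i R.
Proof.
have inF c : R c -> faces i R (cube_face i false c) (cube_face i true c).
  by exists c.
have outF (c : cube T k) x y : faces i R x y ->
    (forall f, c f = if f i then y (restrict i f) else x (restrict i f)) -> R c.
  move=> [c' Rc' [-> ->]] cE; suff -> : c = c' by [].
  apply/funext => f; rewrite cE /cube_face !restrictK.
  by case: ifP => fi; rewrite upd_id.
split=> [[qr sy tr]|[cut flip glue]].
- split=> [c e Rc|c Rc|a b Ra Rb ab].
  + have [q0 q1] := qr _ _ (inF c Rc).
    by case: e; [apply: outF q1 _|apply: outF q0 _] => f;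
      rewrite /cube_face !restrictK if_same.
  + apply: outF (sy _ _ (inF c Rc)) _ => f.
    by rewrite /cube_face !restrictK; case: (f i).
  + have ab' : cube_face i true a = cube_face i false b.
      apply/funext => g; rewrite /cube_face -(upd_extend false true).
      by rewrite ab upd_extend.
    have abF := tr _ (cube_face i true a) _ (inF _ Ra).
    apply: outF (abF _ _) _; first by rewrite ab'; apply: inF Rb.
    by move=> f; rewrite /cube_face !restrictK; case: ifP => fi; rewrite upd_id.
- split=> [_ _ [c Rc [-> ->]]|_ _ [c Rc [-> ->]]|x y z].
  + split; [exists (fun f => c (upd f i false))|exists (fun f => c (upd f i true))];
      by [apply: cut|split; apply/funext => g; rewrite /cube_face upd_extend].
  + exists (fun f => c (upd f i (~~ f i))); first exact: flip.
    by split; apply/funext => g; rewrite /cube_face upd_extend extend_dir.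
  + move=> [a Ra [-> ->]] [b Rb [ab ->]].
    exists (fun f : vertex k => if f i then b f else a f).
      apply: glue => // f; have := congr1 (fun h => h (restrict i f)) ab.
      by rewrite /cube_face !restrictK.
    by split; apply/funext => g; rewrite /cube_face extend_dir.
Qed.

Lemma dim_congruenceP (S : signature) (A : algebra S) k (R : set (cube A k)) :
  dim_congruence R <-> compatible R /\ forall i, dir_closed i R.
Proof. by split=> -[cR dR]; split=> // i; apply/dir_closedP. Qed.

(** The hypothesis forces [p f i = f j]; after composition with [p], cuts, flips and gluings in
    direction [i] become those in direction [j]. *)
Lemma dir_closed_pullback (T : Type) n k (p : vertex n -> vertex k) i j
    (R : set (cube T n)) :
  (forall f e, p (upd f j e) = upd (p f) i e) ->
  dir_closed j R -> dir_closed i [set c | R (fun f => c (p f))].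
Proof.
move=> pU; have pE f : p f i = f j.
  by rewrite -{1}(@upd_id _ f j (f j)) // pU upd_same.
move=> [cut flip glue]; split=> /= [c e|c|a b] Rc.
- have -> : (fun f => c (upd (p f) i e)) = (fun f => c (p (upd f j e))).
    by apply/funext => f; rewrite pU.
  exact: cut Rc.
- have -> : (fun f => c (upd (p f) i (~~ p f i)))
          = (fun f => c (p (upd f j (~~ f j)))).
    by apply/funext => f; rewrite pU pE.
  exact: flip Rc.
- move=> Rb ab.
  have -> : (fun f => if p f i then b (p f) else a (p f))
          = (fun f => if f j then b (p f) else a (p f)).
    by apply/funext => f; rewrite pE.
  by apply: glue Rc Rb _ => f; rewrite !pU.
Qed.

Lemma compatible_pullback (S : signature) (A : algebra S) n k
    (p : vertex n -> vertex k) (R : set (cube A n)) :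
  compatible R -> compatible [set c : cube A k | R (fun f => c (p f))].
Proof. by move=> cR s c Rc; apply: cR. Qed.

(** * Meets of coordinates *)

Definition meet_map n k (u : 'I_n -> 'I_k) (f : vertex n) : vertex k :=
  [ffun i => [forall j, (u j == i) ==> f j]].

Lemma meet_map_comp n k l (u : 'I_k -> 'I_l) (v : 'I_n -> 'I_k) f :
  meet_map (u \o v) f = meet_map u (meet_map v f).
Proof.
apply/ffunP => i; rewrite !ffunE; apply/forallP/forallP => fi j.
- apply/implyP => ui; rewrite ffunE; apply/forallP => h.
  by apply/implyP => /eqP vh; have := fi h; rewrite /= vh ui.
- apply/implyP => ui; have := fi (v j); rewrite ui /= ffunE.
  by move=> /forallP/(_ j); rewrite eqxx.
Qed.

(** The fibre of [u] over [u j] is the singleton of [j], so that coordinate of the image is just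
    [f j], and no other coordinate depends on [f j]. *)
Lemma meet_map_upd n k (u : 'I_n -> 'I_k) j f e :
  (forall j', u j' = u j -> j' = j) ->
  meet_map u (upd f j e) = upd (meet_map u f) (u j) e.
Proof.
move=> uj; apply/ffunP => i; rewrite !ffunE; case: eqP => [->|/eqP iu].
- apply/forallP/idP => [/(_ j)|-> h]; first by rewrite eqxx upd_same.
  by apply/implyP => /eqP /uj ->; rewrite upd_same.
- apply: eq_forallb => h; rewrite updE; case: (h =P j) => // ->.
  by rewrite eq_sym (negbTE iu).
Qed.

(** * Squares of faces in two directions *)

Section Quad.
Variables (T : Type) (n : nat) (B : Type) (q : vertex n -> B) (i j : 'I_n).
Variable R : set (cube T n).
Hypotheses (ij : j != i) (qi : forall f e, q (upd f i e) = q f)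
  (qj : forall f e, q (upd f j e) = q f)
  (Ri : dir_closed i R) (Rj : dir_closed j R).

(* A square of faces: i selects the row and j the column of [a b; c d]. *)
Definition quad (a b c d : B -> T) : cube T n := fun f =>
  if f i then if f j then d (q f) else c (q f)
  else if f j then b (q f) else a (q f).

Let ji : (i == j) = false. Proof. by rewrite eq_sym (negbTE ij). Qed.

Let quadE := (qi, qj, updE, ji, negbTE ij, eqxx).

Lemma quad_cut a b c d : R (quad a b c d) -> R (quad c d c d).
Proof.
move=> /(dir_cut Ri true); congr R; apply/funext => f.
by rewrite /quad !quadE; case: (f i).
Qed.

Lemma quad_flip1 a b c d : R (quad a b c d) -> R (quad c d a b).
Proof.
move=> /(dir_flip Ri); congr R; apply/funext => f.
by rewrite /quad !quadE; case: (f i).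
Qed.

Lemma quad_flip2 a b c d : R (quad a b c d) -> R (quad b a d c).
Proof.
move=> /(dir_flip Rj); congr R; apply/funext => f.
by rewrite /quad !quadE; case: (f i); case: (f j).
Qed.

Lemma quad_glue1 a b c d e g :
  R (quad a b c d) -> R (quad c d e g) -> R (quad a b e g).
Proof.
move=> Ra Rb; have := dir_glue Ri Ra Rb.
have E : forall f, quad a b c d (upd f i true) = quad c d e g (upd f i false).
  by move=> f; rewrite /quad !quadE.
move=> /(_ E); congr R; apply/funext => f.
by rewrite /quad; case: (f i).
Qed.

Lemma quad_glue2 a b c d e g :
  R (quad a b c d) -> R (quad b e d g) -> R (quad a e c g).
Proof.
move=> Ra Rb; have := dir_glue Rj Ra Rb.
have E : forall f, quad a b c d (upd f j true) = quad b e d g (upd f j false).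
  by move=> f; rewrite /quad !quadE.
move=> /(_ E); congr R; apply/funext => f.
by rewrite /quad; case: (f i); case: (f j).
Qed.

(** Swapping the columns gives [x x; y x]; gluing on [x y; x y], the doubled lower row, gives
    [x y; y y], and two flips move the odd corner into place. *)
Lemma quad_corner_sym x y : R (quad x x x y) -> R (quad y y y x).
Proof.
move=> Rxy; apply/quad_flip1/quad_flip2.
exact: quad_glue2 (quad_flip2 Rxy) (quad_cut Rxy).
Qed.

(** The doubled lower row [x y; x y] glued to [y y; y z] gives [x y; x z], which fits below
    [x x; x y]. *)
Lemma quad_corner_trans x y z :
  R (quad x x x y) -> R (quad y y y z) -> R (quad x x x z).
Proof.
move=> Rxy Ryz; apply: (quad_glue1 Rxy).
exact: quad_glue2 (quad_cut Rxy) Ryz.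
Qed.

End Quad.

(* Collapses all the coordinates from m on onto the coordinate m. *)
Definition cap m n (j : 'I_n) : 'I_m.+1 := inord (minn j m).

Arguments cap m {n} j.

Lemma capE m n (j : 'I_n) : cap m j = minn j m :> nat.
Proof. by rewrite inordK // ltnS geq_minr. Qed.

Lemma meet_cap_lt m n (f : vertex n) (i : 'I_m.+1) (j : 'I_n) :
  i < m -> i = j :> nat -> meet_map (cap m) f i = f j.
Proof.
move=> im ij; rewrite ffunE; apply/forallP/idP => [/(_ j)|fj h].
  by move=> /implyP; apply; apply/eqP/val_inj; rewrite /= capE; lia.
apply/implyP => /eqP /(congr1 val) hE; rewrite /= capE in hE.
by suff -> : h = j by []; apply/val_inj => /=; lia.
Qed.

Arguments meet_cap_lt {m n} f {i j} _ _.

Lemma meet_cap_max m n (f : vertex n) :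
  meet_map (cap m) f ord_max = [forall j : 'I_n, (m <= j) ==> f j].
Proof.
rewrite ffunE; apply: eq_forallb => j; congr (_ ==> _).
by rewrite -val_eqE /= capE; lia.
Qed.

(** Directions below [k] are untouched by the merging and are handled by pullback; only the merged
    direction needs the square lemmas. *)
Lemma dim_congruence_meet2 (S : signature) (A : algebra S) k
    (R : set (cube A k.+2)) :
  dim_congruence R ->
  dim_congruence [set c : cube A k.+1 | R (fun f => c (meet_map (cap k) f))].
Proof.
move=> /dim_congruenceP [cR dR]; apply/dim_congruenceP.
split=> [|i]; first exact: compatible_pullback.
have [ik|] := ltnP i k.
  have i2 : i < k.+2 by lia.
  apply: (@dir_closed_pullback _ _ _ _ _ (Ordinal i2)) => // f e.
  have {2}-> : i = cap k (Ordinal i2) by apply/val_inj; rewrite /= capE /=; lia.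
  apply: meet_map_upd => j /(congr1 val); rewrite /= !capE /= => jE.
  by apply/val_inj => /=; lia.
move=> ki; have {i ki} -> : i = ord_max by apply/val_inj => /=; have := ltn_ord i; lia.
(* In the merged direction, [p] and [q] are the two merged coordinates, [w] keeps the other [k], and
   [ext e] appends the merged value [e]. *)
have p2 : k < k.+2 by lia.
pose p : 'I_k.+2 := Ordinal p2; pose q : 'I_k.+2 := ord_max.
have qp : q != p by apply/eqP => /(congr1 val) /=; lia.
pose w (f : vertex k.+2) : vertex k := [ffun h : 'I_k => f (inord (h : nat))].
have wp f e : w (upd f p e) = w f.
  apply/ffunP => h; rewrite !ffunE; case: eqP => // /(congr1 val) /= hE.
  by exfalso; move: hE; have hk := ltn_ord h; rewrite inordK; lia.
have wq f e : w (upd f q e) = w f.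
  apply/ffunP => h; rewrite !ffunE; case: eqP => // /(congr1 val) /= hE.
  by exfalso; move: hE; have hk := ltn_ord h; rewrite inordK; lia.
pose ext e (g : vertex k) : vertex k.+1 :=
  [ffun h => if insub (val h) is Some h' then g h' else e].
have meetE f : meet_map (cap k) f = ext (f p && f q) (w f).
  apply/ffunP => h; rewrite !ffunE; case: insubP => [h' hk hE|hk].
  - have {}hE : h' = h :> nat by [].
    have hk' := ltn_ord h'.
    rewrite ffunE; apply/forallP/idP => [/(_ (inord h'))|fh j].
      move=> /implyP; apply; apply/eqP/val_inj.
      by rewrite /= capE /= inordK; lia.
    apply/implyP => /eqP /(congr1 val) jE; rewrite /= capE in jE.
    suff -> : j = inord h' by [].
    by apply/val_inj; rewrite /= inordK; have := ltn_ord h'; lia.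
  - rewrite /= -leqNgt in hk.
    have hE : h = k :> nat by have := ltn_ord h; lia.
    apply/forallP/andP => [fj|[fp fq] j].
      by split; [have := fj p|have := fj q] => /implyP; apply;
        apply/eqP/val_inj; rewrite /= capE /=; lia.
    apply/implyP => /eqP /(congr1 val) jE; rewrite /= capE in jE.
    have [->|->] // : j = p \/ j = q.
    have hj := ltn_ord j; have [jk|/eqP jk] := eqVneq (j : nat) k; [left|right];
      by apply/val_inj => /=; lia.
have extU e e' g : upd (ext e g) ord_max e' = ext e' g.
  apply/ffunP => h; rewrite !ffunE; case: eqP => [->|/eqP hk].
    by case: insubP => // h' ; rewrite ltnn.
  case: insubP => // hk'; rewrite /= -leqNgt in hk'; have /eqP[] := hk.
  by apply/val_inj => /=; have := ltn_ord h; lia.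
have ext_max e g : ext e g ord_max = e.
  by rewrite -(extU (~~ e)) upd_same.
(* A pulled-back cube is a square [x x; x y], where x and y are the faces of [c] in the merged
   direction. *)
have quad_meet (c : cube A k.+1) : (fun f => c (meet_map (cap k) f)) =
    quad w p q (c \o ext false) (c \o ext false) (c \o ext false) (c \o ext true).
  by apply/funext => f; rewrite meetE /quad /=; case: (f p); case: (f q).
split=> /= [c e Rc|c Rc|a b Ra Rb ab].
(* Making a conjunction true requires fixing both coordinates; making it false requires only one. *)
- case: e.
    have := dir_cut (dR p) true (dir_cut (dR q) true Rc); congr R.
    apply/funext => f; congr c; rewrite !meetE extU !updE !eqxx.
    by rewrite (eq_sym p) (negbTE qp) wq wp.
  have := dir_cut (dR p) false Rc; congr R.
  by apply/funext => f; congr c; rewrite !meetE extU !updE !eqxx wp.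
- rewrite quad_meet in Rc.
  have := quad_corner_sym qp wp wq (dR p) (dR q) Rc; congr R.
  apply/funext => f; rewrite meetE extU /quad /=.
  by rewrite ext_max; case: (f p); case: (f q).
- rewrite quad_meet in Ra; rewrite quad_meet in Rb.
  have ab' : a \o ext true = b \o ext false.
    by apply/funext => g; have := ab (ext true g); rewrite !extU.
  rewrite ab' in Ra.
  have := quad_corner_trans qp wp wq (dR p) (dR q) Ra Rb; congr R.
  apply/funext => f; rewrite meetE /quad /=.
  by rewrite ext_max; case: (f p); case: (f q).
Qed.

(** Induction on the number [l] of extra coordinates: the last two are merged first, and the
    successive [cap] maps compose to [cap m]. *)
Lemma dim_congruence_meet (S : signature) (A : algebra S) n m
    (R : set (cube A n)) : m < n ->
  dim_congruence R ->
  dim_congruence [set c : cube A m.+1 | R (fun f => c (meet_map (cap m) f))].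
Proof.
move=> mn; have [l nE] : exists l, n = (l + m).+1.
  by exists (n - m.+1); lia.
move: mn => _; subst n; elim: l => [|l IH] in R *.
  have capid f : meet_map (cap m) f = f :> vertex m.+1.
    apply/ffunP => i; rewrite ffunE.
    have cid (j : 'I_m.+1) : cap m j = j.
      by apply/val_inj; rewrite /= capE; have := ltn_ord j; lia.
    apply/forallP/idP => [/(_ i)|fi j]; first by rewrite cid eqxx.
    by rewrite cid; apply/implyP => /eqP ->.
  suff -> : [set c : cube A m.+1 | R (fun f => c (meet_map (cap m) f))] = R by [].
  apply/funext => c /=; congr R; apply/funext => f.
  by rewrite capid.
move=> /dim_congruence_meet2 /IH; congr dim_congruence.
apply/funext => c /=; congr R; apply/funext => f; rewrite -meet_map_comp.
congr (c (meet_map _ f)); apply/funext => j; apply/val_inj.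
by rewrite /= !capE -minnA (minn_idPr (leq_addl l m)).
Qed.

(** * Centrality of the corner relation *)

Section Corner.
Variables (S : signature) (A : algebra S) (k : nat) (R : set (cube A k)).
Hypotheses (dR : dim_congruence R) (constR : forall x, R (fun=> x)).

Let dirR i : dir_closed i R.
Proof. by have /dim_congruenceP[_ h] := dR. Qed.

(** A self-map of [bool] is constant, the identity or negation, so each coordinate needs a cut,
    nothing or a flip. *)
Lemma dir_map (t : 'I_k -> bool -> bool) c :
  R c -> R (fun f => c [ffun j => t j (f j)]).
Proof.
suff H (s : seq 'I_k) : forall c, R c ->
    R (fun f => c [ffun j => if j \in s then t j (f j) else f j]).
  move=> /(H (enum 'I_k)); congr R; apply/funext => f; congr c.
  by apply/ffunP => j; rewrite !ffunE mem_enum.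
elim: s => [|i s IH] {}c Rc.
  by move: Rc; congr R; apply/funext => f; congr c; apply/ffunP => j; rewrite ffunE.
have [si|si] := boolP (i \in s).
  have := IH c Rc; congr R; apply/funext => f; congr c.
  by apply/ffunP => j; rewrite !ffunE in_cons; case: eqP => // ->; rewrite si.
have {}IH := IH _ Rc.
(* [Some e] encodes the constant map [e]; for [None], the value at [true] separates identity from
   negation. *)
have [e tE] : exists e : option bool, t i =1 fun b => if e is Some e then e else
    if t i true then b else ~~ b.
  case t1: (t i true); case t0: (t i false);
    by [exists (Some true); case|exists (Some false); case|exists None; case].
have step : R (fun f => c (let g := upd f i (t i (f i)) in
     [ffun j => if j \in s then t j (g j) else g j])).
  case: e tE => [e|] tE.
    have := dir_cut (dirR i) e IH; congr R; apply/funext => f.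
    by rewrite tE.
  case t1: (t i true) tE => tE.
    move: IH; congr R; apply/funext => f; rewrite tE.
    by rewrite (@upd_id _ f i (f i)).
  have := dir_flip (dirR i) IH; congr R; apply/funext => f.
  by rewrite tE.
move: step; congr R; apply/funext => f; congr c; apply/ffunP => j.
rewrite !ffunE in_cons; case: eqP => [->|] //=.
by rewrite (negbTE si).
Qed.

Lemma dir_join i e (a b : cube A k) : R a -> R b ->
  (forall f, a (upd f i e) = b (upd f i (~~ e))) ->
  R (fun f => if (f : vertex k) i == e then b f else a f).
Proof.
case: e => Ra Rb ab.
  have := dir_glue (dirR i) Ra Rb ab; congr R; apply/funext => f.
  by case: (f i).
have := dir_glue (dirR i) Rb Ra (fun f => esym (ab f)); congr R.
by apply/funext => f; case: (f i).
Qed.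

(** The flip of [b] is glued to [a] along their common face, so the face of [b] at [e] takes the
    place opposite to that of [a]. *)
Lemma dir_slide i e (a b : cube A k) : R a -> R b ->
  (forall f : vertex k, f i = ~~ e -> a f = b f) ->
  R (fun f => if (f : vertex k) i == e then a f else b (upd f i e)).
Proof.
move=> Ra Rb ab.
have E f : b (upd (upd f i e) i (~~ (upd f i e) i)) = a (upd f i (~~ e)).
  by rewrite upd_upd upd_same ab // upd_same.
have := dir_join (dir_flip (dirR i) Rb) Ra E.
congr R; apply/funext => f; case: eqP => // /eqP fe.
by congr (b (upd f i _)); case: (f i) fe; case: (e).
Qed.

Definition corner x y : cube A k := fun f => if [forall j, f j] then y else x.

(** Flipping the coordinates where [v] is false exchanges [v] with the top vertex, and the flip is
    its own inverse. *)
Lemma corner_at (v : vertex k) x y :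
  R (corner x y) <-> R (fun f => if f == v then y else x).
Proof.
split=> /(dir_map (fun j b => b == v j)); congr R; apply/funext => f.
  congr (if _ then _ else _); apply/forallP/eqP => [fv|-> j].
    by apply/ffunP => j; apply/eqP; have := fv j; rewrite ffunE.
  by rewrite ffunE.
congr (if _ then _ else _); apply/eqP/forallP => [fv j|fT].
  by have := congr1 (fun g : vertex k => g j) fv; rewrite ffunE; case: (f j); case: (v j).
by apply/ffunP => j; rewrite ffunE (fT j); case: (v j).
Qed.

(** The coordinates of [c] are first frozen to those of [v], where the claim is the corner
    hypothesis, and then released one at a time by gluing. *)
Lemma corner_replace c (v : vertex k) x : R c -> R (corner (c v) x) ->
  R (fun f => if f == v then x else c f).
Proof.
move=> Rc Rv.
suff H (s : seq 'I_k) : R (fun f => if f == v then x else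
    c [ffun j => if j \in s then f j else v j]).
  have := H (enum 'I_k); congr R; apply/funext => f; case: eqP => // _.
  by congr c; apply/ffunP => j; rewrite ffunE mem_enum.
elim: s => [|i s IH].
  move/(corner_at v): Rv; congr R; apply/funext => f; case: eqP => // _.
  by congr c; apply/ffunP => j; rewrite ffunE.
have [si|si] := boolP (i \in s).
  move: IH; congr R; apply/funext => f; congr (if _ then _ else c _).
  by apply/ffunP => j; rewrite !ffunE in_cons; case: eqP => // ->; rewrite si.
pose b f := if f == v then x else c [ffun j => if j \in s then f j else v j].
have Rb : R b by [].
(* [a] is the unmodified cube with [i] released as well; it supplies the face away from [v], while
   [b] supplies the face containing [v]. *)
pose a (f : vertex k) := c [ffun j => if j \in i :: s then f j else v j].
have Ra : R a := dir_map (fun j b => if j \in i :: s then b else v j) Rc.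
have ab f : a (upd f i (v i)) = b (upd f i (~~ v i)).
  rewrite /a /b upd_neq; last by case: (v i).
  congr c; apply/ffunP => j; rewrite !ffunE in_cons.
  by case: eqP => // ->; rewrite (negbTE si).
have := dir_join Ra Rb ab; congr R; apply/funext => f.
have [fi|fi] := eqVneq (f i) (v i).
  rewrite /b; congr (if _ then _ else c _); apply/ffunP => j.
  by rewrite !ffunE in_cons; case: eqP => // ->; rewrite (negbTE si) fi.
by case: eqP => // fv; rewrite fv eqxx in fi.
Qed.

Hypothesis k_gt0 : 0 < k.

Let corner_dim := dim_congruence_meet k_gt0 dR.

(** With all coordinates merged, [corner_dim] concerns cubes of dimension one; this identity lets
    symmetry and transitivity of the corner relation be read off from it. *)
Lemma corner_pair x y :
  corner x y = fun f => cube_pair (@ord0 0) x y (meet_map (cap 0) f).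
Proof.
apply/funext => f; rewrite /cube_pair /corner ffunE.
congr (if _ then _ else _); apply: eq_forallb => j.
suff -> : cap 0 j == ord0 by [].
by apply/eqP/val_inj; rewrite /= capE minn0.
Qed.

Lemma corner_equiv : Equivalence (fun x y => R (corner x y)).
Proof.
have /dim_congruenceP[_ /(_ ord0) [_ flip glue]] := corner_dim.
split=> [x|x y|x y z].
- by have := constR x; congr R; apply/funext => f; rewrite /corner if_same.
- rewrite !corner_pair => /flip /=; congr R; apply/funext => f.
  by rewrite /cube_pair upd_same; case: (meet_map _ _ _).
- rewrite !corner_pair => Rxy Ryz.
  have E (f : vertex 1) : cube_pair ord0 x y (upd f ord0 true) =
             cube_pair ord0 y z (upd f ord0 false).
    by rewrite /cube_pair !upd_same.
  have /= := glue _ _ Rxy Ryz E; congr R; apply/funext => f.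
  by rewrite /cube_pair; case: (meet_map _ _ _).
Qed.

Lemma corner_compat (s : symbol S) (x y : 'I_(arity s) -> A) :
  (forall j, R (corner (x j) (y j))) -> R (corner (op x) (op y)).
Proof.
move=> xy; have [cR _] := dR; have := cR s _ xy; congr R.
by apply/funext => f; rewrite /corner; case: ifP.
Qed.

Definition corner_con : Con A := Congruence corner_equiv corner_compat.

Lemma corner_centrality i : centrality corner_con i R.
Proof.
have [refl sym _] := corner_equiv.
apply/centralityP => c v Rc off; set x := c _; set y := c _.
pose w := upd v i true.
(* First make trivial all the lines of c but the one at v... *)
have R1 : R (fun f => if f == w then y else c (upd f i false)).
  suff H (s : seq (vertex k)) : R (fun f => if [&& f \in s, f i & f != w]
      then c (upd f i false) else c f).
    have := H (enum {: vertex k}); congr R; apply/funext => f.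
    rewrite mem_enum /=; have [->|_] := eqVneq f w; first by rewrite andbF.
    by case fi: (f i) => //=; rewrite upd_id.
  elim: s => // g s IH.
  have [/andP[gi gw]|gw] := boolP (g i && (g != w)); last first.
    move: IH; congr R; apply/funext => f; rewrite in_cons.
    by case: (f =P g) => //= ->; rewrite (negbTE gw) andbF.
  have := corner_replace (v := g) (x := c (upd g i false)) IH.
  (* If [g] was already treated, its value is already the lower one and reflexivity suffices;
     otherwise its line avoids [v], and [off] licenses the replacement. *)
  rewrite gi gw !andbT; case: ifP => gs.
    move=> /(_ (refl _)); congr R; apply/funext => f; rewrite in_cons.
    by case: (f =P g) => //= ->; rewrite gi gw.
  have goff : upd g i false != upd v i false.
    apply: contra gw => /eqP gv; apply/eqP.
    by rewrite /w -(upd_upd v i false) -gv upd_upd upd_id.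
  have := sym _ _ (off g goff); rewrite (upd_id gi) => Rg /(_ Rg).
  congr R; apply/funext => f; rewrite in_cons.
  by case: (f =P g) => //= ->; rewrite gi gw.
(* ... then slide the trivial lines so that all their entries become x. *)
pose cut (s : seq 'I_k) (f : vertex k) : vertex k :=
  [ffun j => if j == i then false else if j \in s then v j else f j].
(* Once [s] lists every coordinate, [cut s f] is [upd v i false], where [c] takes the value [x];
   what remains is a corner at [w]. *)
suff H s : R (fun f => if f == w then y else c (cut s f)).
  apply/(corner_at w); have := H (enum 'I_k); congr R; apply/funext => f.
  case: (f =P w) => // _; congr c; apply/ffunP => j.
  by rewrite !ffunE mem_enum.
elim: s => [|j s IH].
  move: R1; congr R; apply/funext => f; by case: (f =P w).
have [ji|ji] := eqVneq j i.
  move: IH; congr R; apply/funext => f; case: (f =P w) => // _.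
  congr c; apply/ffunP => h; rewrite !ffunE in_cons; case: (h =P i) => // /eqP hi.
  by rewrite ji (negbTE hi).
(* This cube lacks the exceptional value at [w]. As [w j = v j], it agrees with the current cube on
   the face opposite [v j], so [dir_slide] can overwrite that face. *)
have Rc' : R (fun f => c (cut s f)).
  exact: (dir_map (fun h b => if h == i then false else if h \in s then v h else b) Rc).
have wj : w j = v j by rewrite updE (negbTE ji).
have := dir_slide (i := j) (e := v j) IH Rc'.
have E (f : vertex k) : f j = ~~ v j -> (if f == w then y else c (cut s f)) = c (cut s f).
  by move=> fj; case: eqP => // fw; move: fj; rewrite fw wj; case: (v j).
move=> /(_ E); congr R; apply/funext => f.
have [fj|fj] := eqVneq (f j) (v j).
  case: (f =P w) => // _; congr c; apply/ffunP => h; rewrite !ffunE in_cons.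
  by case: (h =P j) => // ->; rewrite fj if_same.
case: eqP => [fw|_]; first by rewrite fw wj eqxx in fj.
congr c; apply/ffunP => h; rewrite !ffunE in_cons.
by case: (h =P j) => // ->; rewrite if_same.
Qed.

End Corner.

(** * Nested hypercommutators *)

Section Delta.
Variables (S : signature) (A : algebra S).

(** In the form [dir_closed], the conditions are closure conditions on cubes and hence pass to
    intersections. *)
Lemma Delta_dim k (beta : k.-tuple (Con A)) : dim_congruence (Delta beta).
Proof.
apply/dim_congruenceP; split=> [s c Dc R [dR gR]|i].
  by have [cR _] := dR; apply: cR => j; apply: Dc.
have dir (R : set (cube A k)) : dim_congruence R -> dir_closed i R.
  by move=> /dim_congruenceP[].
split=> [c e Dc R RP|c Dc R RP|a b Da Db ab R RP]; have [/dir dR _] := RP.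
- by apply: (dir_cut dR); apply: Dc.
- by apply: (dir_flip dR); apply: Dc.
- by apply: (dir_glue dR) ab; [apply: Da|apply: Db].
Qed.

Lemma Delta_pair k (beta : k.-tuple (Con A)) i x y :
  tnth beta i x y -> Delta beta (cube_pair i x y).
Proof. by move=> xy R [_ gR]; apply: gR; exists i, x, y. Qed.

Lemma Delta_sub k (beta : k.-tuple (Con A)) (R : set (cube A k)) :
  dim_congruence R ->
  (forall i x y, tnth beta i x y -> R (cube_pair i x y)) ->
  Delta beta `<=` R.
Proof. by move=> dR gR c; apply; split=> // _ [i [x [y [xy ->]]]]; apply: gR. Qed.

Lemma Delta_const k (beta : k.-tuple (Con A)) x : 0 < k -> Delta beta (fun=> x).
Proof.
move=> k_gt0; have [refl _ _] := con_equiv (tnth beta (Ordinal k_gt0)).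
have := Delta_pair (refl x); congr (Delta beta); apply/funext => f.
by rewrite /cube_pair if_same.
Qed.

(** The corner congruence is central for [Delta beta], so it is one of the congruences whose meet is
    taken. *)
Lemma hypercommutator_corner k (beta : k.-tuple (Con A)) x y : 0 < k ->
  hypercommutator beta x y -> Delta beta (corner x y).
Proof.
move=> k_gt0 xy.
pose cD := corner_con (Delta_dim beta)
    (fun z => Delta_const (beta := beta) z k_gt0) k_gt0.
by apply: (xy cD) => i _; apply: corner_centrality.
Qed.

(** Composition with the coordinate selection along [u] adds dummy coordinates; generators go to
    generators, and direction [i] becomes direction [u i]. *)
Lemma Delta_restrict n k (theta : n.-tuple (Con A)) (beta : k.-tuple (Con A))
    (u : 'I_k -> 'I_n) : injective u ->
  (forall i, tnth beta i = tnth theta (u i)) ->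
  forall c, Delta beta c -> Delta theta (fun f => c [ffun i => f (u i)]).
Proof.
move=> inj_u betaE; apply: Delta_sub => [|i x y].
  have /dim_congruenceP[cD dD] := Delta_dim theta.
  apply/dim_congruenceP; split=> [|i].
    exact: (@compatible_pullback _ _ _ _ (fun f : vertex n => [ffun i => f (u i)])).
  apply: (@dir_closed_pullback _ _ _
    (fun f : vertex n => [ffun i => f (u i)]) _ (u i)) => // f e.
  by apply/ffunP => j; rewrite !ffunE (inj_eq inj_u).
rewrite betaE => /Delta_pair /=; congr (Delta theta); apply/funext => f.
by rewrite /cube_pair ffunE.
Qed.

Lemma hypercommutator_nested n m (theta : n.-tuple (Con A))
    (beta : m.+1.-tuple (Con A)) : m < n ->
  (forall (i : 'I_m.+1) (j : 'I_n), i < m -> i = j :> nat ->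
     tnth beta i = tnth theta j) ->
  (forall x y, tnth beta ord_max x y ->
     Delta theta (fun f => if meet_map (cap m) f ord_max then y else x)) ->
  con_le (hypercommutator beta) (hypercommutator theta).
Proof.
move=> mn beta_lt beta_max x y xy d dC; apply: xy => i iE.
have {i iE} -> : i = ord_max by apply/val_inj; rewrite /= iE subn1.
have subD : Delta beta `<=` [set c | Delta theta (fun f => c (meet_map (cap m) f))].
  apply: Delta_sub; first exact: dim_congruence_meet mn (Delta_dim theta).
  move=> i x' y' xy'; have := ltn_ord i; rewrite ltnS leq_eqVlt => /orP[/eqP|] im.
    have iE : i = ord_max by apply/val_inj.
    by rewrite iE in xy' *; apply: beta_max.
  have i_n := ltn_trans im mn.
  rewrite (beta_lt i (Ordinal i_n)) // in xy'.
  have := Delta_pair xy'; congr (Delta theta); apply/funext => f.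
  by rewrite /cube_pair (meet_cap_lt _ (j := Ordinal i_n)).
apply/centralityP => c v Dc off.
have l_n : n.-1 < n by lia.
pose l : 'I_n := Ordinal l_n.
have /centralityP dl : centrality d l (Delta theta) by apply: dC; rewrite /= subn1.
(* Filling the merged coordinates of [v'] with [true] makes its line in direction [l] map onto the
   line of [c] at [v]. *)
pose v' : vertex n := [ffun j : 'I_n => if j < m then v (inord j) else true].
(* Moving along [l] changes the conjunction only when all other merged coordinates are true;
   otherwise the line is constant. *)
have meet_l f e : meet_map (cap m) (upd f l e) =
    upd (meet_map (cap m) f) ord_max
      (e && [forall j : 'I_n, (m <= j) && (j != l) ==> f j]).
  apply/ffunP => i; rewrite updE; case: eqP => [->|/eqP im].
    rewrite meet_cap_max; apply/forallP/andP => [fj|[eT /forallP fj] j].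
      split; first by have := fj l; rewrite upd_same; case: (e) => //=; lia.
      apply/forallP => j; apply/implyP => /andP[mj jl].
      by have := fj j; rewrite mj updE (negbTE jl).
    by apply/implyP => mj; rewrite updE; have := fj j; rewrite mj; case: eqP.
  have {}im : i < m by move: im; rewrite -val_eqE /=; have := ltn_ord i; lia.
  have i_n := ltn_trans im mn.
  rewrite !(meet_cap_lt _ (j := Ordinal i_n)) // updE.
  by case: eqP => // /(congr1 val) /= il; exfalso; lia.
have Mv b : upd (meet_map (cap m) v') ord_max b = upd v ord_max b.
  apply/ffunP => i; rewrite !updE; case: eqP => // /eqP im.
  have {}im : i < m by move: im; rewrite -val_eqE /=; have := ltn_ord i; lia.
  have i_n := ltn_trans im mn.
  by rewrite (meet_cap_lt _ (j := Ordinal i_n)) // ffunE /= im inord_val.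
have v'T : [forall j : 'I_n, (m <= j) && (j != l) ==> v' j].
  apply/forallP => j; apply/implyP => /andP[mj _].
  by rewrite ffunE ltnNge mj.
have /= := dl _ v' (subD c Dc); rewrite (meet_l v' false) (meet_l v' true) v'T !Mv.
apply=> f fv; rewrite (meet_l f false) (meet_l f true) /=.
(* A constant line belongs to [d] by reflexivity. In the other case [f] is determined off [l] by its
   first [m] coordinates, so distinct lines stay distinct in [c]. *)
case: (boolP [forall j, _]) => [/forallP fT|_]; last first.
  by have [refl _ _] := con_equiv d; apply: refl.
apply: off; apply: contra fv => /eqP fv.
apply/eqP/ffunP => j; rewrite !updE; case: eqP => // /eqP jl; rewrite ffunE.
have [jm|mj] := ltnP j m; last by have := fT j; rewrite mj jl.
have := congr1 (fun g : vertex m.+1 => g (inord j)) fv.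
have jE : (inord j : 'I_m.+1) = j :> nat by rewrite inordK // ltnS ltnW.
rewrite !updE (meet_cap_lt _ (j := j)) ?jE //.
by case: eqP => // /(congr1 val) /=; rewrite jE; lia.
Qed.

End Delta.

Theorem theorem4p13 (S : signature) (A : algebra S) (n : nat) (hn : 3 <= n)
    (theta : n.-tuple (Con A)) (m : nat) (hm1 : 1 <= m) (hm2 : m <= n - 2) :
  con_le
    (hypercommutator
       [tuple of rcons (take m theta) (hypercommutator [tuple of drop m theta])])
    (hypercommutator theta).
Proof.
have mn : minn m n = m by lia.
have m_n : m < n by lia.
set eta := hypercommutator [tuple of drop m theta].
(* The tuple has length [(minn m n).+1] in its type; generalising it while keeping its underlying
   sequence allows the length to be rewritten to [m.+1]. *)
have : tval [tuple of rcons (take m theta) eta] = rcons (take m theta) eta by [].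
move: [tuple of rcons (take m theta) eta]; rewrite mn => beta betaE.
have sz : size (take m theta) = m by rewrite size_take size_tuple m_n.
apply: hypercommutator_nested => // [i j im ij|x y].
  by rewrite !(tnth_nth eta) betaE nth_rcons sz im nth_take // ij.
rewrite (tnth_nth eta) betaE nth_rcons sz ltnn eqxx => xy.
have := hypercommutator_corner _ xy; rewrite subn_gt0 => /(_ m_n) Dxy.
have u_n (i : 'I_(n - m)) : m + i < n by have := ltn_ord i; lia.
(* The shift by [m] places the inner corner cube on the last [n - m] coordinates of [theta]. *)
pose u i := Ordinal (u_n i).
have u_inj : injective u.
  by move=> i j /(congr1 val) /= ij; apply/val_inj => /=; lia.
have uE i : tnth [tuple of drop m theta] i = tnth theta (u i).
  by rewrite !(tnth_nth eta) nth_drop.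
have := Delta_restrict u_inj uE Dxy; congr (Delta theta); apply/funext => f.
rewrite /corner meet_cap_max; congr (if _ then _ else _).
apply/forallP/forallP => fT j; last first.
  by rewrite ffunE; have := fT (u j); rewrite /= leq_addr.
apply/implyP => mj; have jm : j - m < n - m by have := ltn_ord j; lia.
have := fT (Ordinal jm); rewrite ffunE; congr (is_true (f _)).
by apply/val_inj; rewrite /= subnKC.
Qed.
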